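(* Let $\varepsilon>0$, $\delta>0$, and suppose that $f_1,\dots,f_N,g:Q\to\mathbb{R}$ satisfy, with constants $M_1,\dots,M_N>0$ and $M_g>0$, for all $x,y\in Q$ and $i=1,\dots,N$, $$f_i(x)+\psi_{f_i}(y,x)\le f_i(y),\qquad -\psi_{f_i}(y,x)\le M_i\sqrt{2V_d(y,x)}+\delta,$$ $$g(x)+\psi_g(y,x)\le g(y),\qquad -\psi_g(y,x)\le M_g\sqrt{2V_d(y,x)}+\delta,$$ where $\psi_{f_i}(y,x),\psi_g(y,x)$ are convex in $y$ and $\psi_{f_i}(x,x)=\psi_g(x,x)=0$ for every $x\in Q$. Put $M=\max\{M_1,\dots,M_N,M_g\}$. Let $x^*$ be a solution of $$\frac1N\sum_{i=1}^Nf_i(x)\to\min_{x\in Q,\ g(x)\le0},$$ and let $\Theta_0>0$ satisfy $d(x^* )\le\Theta_0^2$. Suppose Algorithm E (described in the context) works exactly $N$ productive steps; let $x^{k_i}$ be the point at which its $i$-th productive step is made ($i=1,\dots,N$) and let $|J|$ be the number of its non-productive steps. Then, after the stopping of the algorithm, $$\frac1N\sum_{i=1}^Nf_i(x^{k_i})-\min_{x\in Q}\frac1N\sum_{i=1}^Nf_i(x)\le\kappa,\qquad \kappa=\frac{|J|}{N}\left(-\frac{\varepsilon}{2}\right)+\left(\frac{\varepsilon}{2}+\delta\right)+\frac{M^2\Theta_0^2}{N\varepsilon}.$$ Moreover, when the regret (the left-hand side of this inequality) is non-negative, there will be no more than $O(N)$ non-productive steps.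
   Context: $(E,\|\cdot\|)$ is a finite-dimensional normed space and $Q\subset E$ is a closed convex set. The reference function $d:Q\to\mathbb{R}$ is any convex (not necessarily strongly convex) differentiable function. The Bregman divergence is $V_d(y,x)=d(y)-d(x)-\langle\nabla d(x),y-x\rangle$ for $x,y\in Q$. Proximal mapping: for $h>0$, $\mathrm{Mirr}_h(x,\psi)=\arg\min_{y\in Q}\{\psi(y,x)+\frac1h V_d(y,x)\}$. Algorithm E. Input: $\varepsilon>0$, $\delta>0$, $M>0$, $N$, $\Theta_0$ with $d(x^* )\le\Theta_0^2$. Start from $x^0=\arg\min_{x\in Q}d(x)$, $i=1$, $k=0$, and set $h=\frac{\varepsilon}{M^2}$. Repeat: if $g(x^k)\le\varepsilon+\delta$, set $x^{k+1}=\mathrm{Mirr}_h(x^k,\psi_{f_i})$ (productive step; this is the $i$-th productive step, made at $x^{k_i}:=x^k$), then increase both $i$ and $k$ by 1; otherwise set $x^{k+1}=\mathrm{Mirr}_h(x^k,\psi_g)$ (non-productive step) and increase $k$ by 1; until $i=N+1$. $J$ denotes the set of indices of non-productive steps.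
   Formalization: The minimum in the regret is taken over x in Q with g(x) ≤ 0 (the problem solved by x* ), not over all of Q, and d(x^0) = min_Q d ≥ 0 is assumed; without either change the bound is false. The O(N) constant depends on ε, δ, Θ_0 and an upper bound for M. *)

(* Defs.v *)
From HB Require Import structures.
From mathcomp Require Import all_boot all_order all_algebra.
From mathcomp Require Import all_classical all_reals all_analysis.
Set Implicit Arguments.
Unset Strict Implicit.
Unset Printing Implicit Defensive.
Import Order.TTheory GRing.Theory Num.Theory.
Import numFieldNormedType.Exports.
Local Open Scope classical_set_scope.
Local Open Scope ring_scope.

#[short(type="normedVectType")]
HB.structure Definition NormedVector (R : realType) :=
  {E of NormedModule R E & Vector R E}.

Definition argmin (R : realType) (T : Type) (A : set T) (F : T -> R) : set T :=
  [set z | A z /\ forall y, A y -> F z <= F y].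

(* Functions on Q are total functions on E of which only the values on Q
   matter.  In particular d need not be differentiable in a neighbourhood of Q:
   its differential at x is taken along the filter [within Q (nbhs x)].  When Q
   has empty interior this differential is not unique as a linear form on E,
   but its values at y - x for y in Q are, Q being convex. *)
Definition differentiable_on (R : realType) (E : normedModType R) (Q : set E)
    (d : E -> R) : Prop :=
  forall x, Q x -> differentiable d (within Q (nbhs x)).

Definition bregman (R : realType) (E : normedModType R) (Q : set E)
    (d : E -> R) (y x : E) : R :=
  d y - d x - 'd d (within Q (nbhs x)) (y - x).

Definition Mirr (R : realType) (E : normedModType R) (Q : set E) (d : E -> R)
    (h : R) (x : E) (psi : E -> E -> R) : set E :=
  argmin Q (fun y => psi y x + h^-1 * bregman Q d y x).

Definition relative_model (R : realType) (E : normedModType R) (Q : set E)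
    (d : E -> R) (delta M : R) (f : E -> R) (psi : E -> E -> R) : Prop :=
  [/\ forall x y, Q x -> Q y -> f x + psi y x <= f y,
      forall x y, Q x -> Q y ->
        - psi y x <= M * Num.sqrt (2 * bregman Q d y x) + delta,
      forall x, Q x -> convex_function Q (psi^~ x)
    & forall x, Q x -> psi x x = 0].

Definition average (R : realType) (T : Type) (N : nat) (f : 'I_N -> T -> R)
    (x : T) : R :=
  N%:R^-1 * \sum_(i < N) f i x.

Definition productive (R : realType) (T : Type) (eps delta : R) (g : T -> R)
    (x : T) : bool :=
  g x <= eps + delta.

(* [algorithmE_run ... K i x]: the algorithm stops after exactly K steps, x k
   being the iterate and i k the counter at the beginning of step k.  The
   counter starts at 0 rather than 1, so that the loop goes on as long as
   i k < N; the values of x and i beyond K are irrelevant.  A minimizer need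
   not be unique, whence memberships in [argmin] and [Mirr]. *)
Record algorithmE_run (R : realType) (E : normedModType R) (Q : set E)
    (d : E -> R) (eps delta M : R) (N : nat) (g : E -> R)
    (psif : 'I_N -> E -> E -> R) (psig : E -> E -> R)
    (K : nat) (i : nat -> nat) (x : nat -> E) : Prop := AlgorithmERun {
  run_start : argmin Q d (x 0%N) /\ i 0%N = 0%N;
  run_productive : forall k, (k < K)%N -> productive eps delta g (x k) ->
    i k.+1 = (i k).+1 /\
    exists j : 'I_N,
      i k = j /\ Mirr Q d (eps / M ^+ 2) (x k) (psif j) (x k.+1);
  run_nonproductive : forall k, (k < K)%N -> ~~ productive eps delta g (x k) ->
    i k.+1 = i k /\ Mirr Q d (eps / M ^+ 2) (x k) psig (x k.+1);
  run_continue : forall k, (k < K)%N -> (i k < N)%N;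
  run_stop : i K = N
}.

Definition nonproductive_steps (R : realType) (T : Type) (eps delta : R)
    (g : T -> R) (K : nat) (x : nat -> T) : {set 'I_K} :=
  [set k : 'I_K | ~~ productive eps delta g (x k)].

(* The minimum is that of the constrained problem, over the y in Q with
   g y <= 0: an algorithm that keeps g below eps + delta cannot compete with
   infeasible points.  It is an attained infimum as soon as [argmin] is
   inhabited. *)
Definition regret (R : realType) (T : Type) (Q : set T) (g : T -> R)
    (N : nat) (f : 'I_N -> T -> R) (z : 'I_N -> T) : R :=
  N%:R^-1 * (\sum_(i < N) f i (z i))
  - inf [set average f y | y in Q `&` [set y | g y <= 0]].

Definition kappa (R : realType) (eps delta M Theta0 : R) (N nJ : nat) : R :=
  nJ%:R / N%:R * (- (eps / 2)) + (eps / 2 + delta)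
  + M ^+ 2 * Theta0 ^+ 2 / (N%:R * eps).

(* Main.v *)
(* With V the Bregman divergence and h = eps / M^2, first-order optimality of a
   proximal step z = Mirr_h (x, psi) and the three-point identity for V give
     h psi(z, x) + V(z, x) + V(y, z) <= h psi(y, x) + V(y, x)   for all y in Q.
   The lower bound on psi and AM-GM absorb V(z, x), so a step for a model of F
   yields
     h (F x - F y) + V(y, z) <= V(y, x) + h (eps / 2 + delta).
   At y = xstar a non-productive step gains h (eps + delta) on the left, hence
   lowers V(xstar, -) by at least h eps / 2, while a productive step pays for
   its term of the regret.  Summation over the steps leaves V(xstar, x 0), which
   is at most d xstar because x 0 minimizes d and 0 <= d (x 0). *)
Require Import Defs.
From mathcomp Require Import all_boot all_order all_algebra.
From mathcomp Require Import all_classical all_reals all_analysis.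
From mathcomp Require Import ring lra.
Set Implicit Arguments.
Unset Strict Implicit.
Unset Printing Implicit Defensive.
Import Order.TTheory GRing.Theory Num.Theory.
Import numFieldNormedType.Exports.
Local Open Scope classical_set_scope.
Local Open Scope ring_scope.

Lemma convex_set_segment (R : numDomainType) (E : lmodType R) (Q : set E)
    (x y : E) (t : R) :
  convex_set Q -> Q x -> Q y -> 0 <= t <= 1 -> Q (t *: y + (1 - t) *: x).
Proof.
move=> cQ Qx Qy /andP[t0 t1].
by have := cQ y x (Itv01 t0 t1) (mem_set Qy) (mem_set Qx); rewrite inE.
Qed.

Lemma convex_function_segment (R : numFieldType) (E : lmodType R) (Q : set E)
    (f : E -> R) (x y : E) (t : R) :
  convex_function Q f -> Q x -> Q y -> 0 <= t <= 1 ->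
  f (t *: y + (1 - t) *: x) <= t * f y + (1 - t) * f x.
Proof.
move=> cf Qx Qy /andP[t0 t1].
exact: (cf (Itv01 t0 t1) y x (mem_set Qy) (mem_set Qx)).
Qed.

Lemma near_right0_01 (R : realType) : \forall t \near (0 : R)^'+, 0 < t < 1.
Proof.
near=> t; apply/andP; split; near: t.
- exact: nbhs_right_gt.
- exact: nbhs_right_lt.
Unshelve. all: by end_near. Qed.

(** * One-sided derivatives along segments of [Q], and proximal steps *)

Section directional_derivative.
Context (R : realType) (E : normedModType R) (Q : set E) (d : E -> R).
Hypotheses (cvxQ : convex_set Q) (diffd : differentiable_on Q d).
Implicit Types (x y : E) (a t : R).

(** By convexity the segment stays in [Q], so a statement along [within Q (nbhs x)], such as the
    little-o defining the differential, becomes one about [t] tending to 0 from the right. *)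
Lemma segment_cvg_within x y : Q x -> Q y ->
  t *: y + (1 - t) *: x @[t --> 0^'+] --> within Q (nbhs x).
Proof.
move=> Qx Qy.
have zE t : t *: y + (1 - t) *: x = t *: (y - x) + x.
  by rewrite scalerBl scale1r scalerBr [x - _]addrC addrA.
have zx : t *: (y - x) + x @[t --> 0^'+] --> x.
  rewrite -[X in _ --> X]add0r -(scale0r (y - x)).
  apply: cvgD; last exact: cvg_cst.
  by apply: cvgZr_tmp; apply: cvg_at_right_filter; exact: cvg_id.
move=> P /zx QP.
have {}QP : \forall t \near 0^'+, Q (t *: (y - x) + x) -> P (t *: (y - x) + x).
  exact: QP.
change (\forall t \near (0 : R)^'+, P (t *: y + (1 - t) *: x)).
near=> t; rewrite zE; suff : Q (t *: (y - x) + x) by near: t.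
rewrite -zE; apply: convex_set_segment => //.
have /andP[t0 t1] : 0 < t < 1 by near: t; exact: near_right0_01.
by rewrite !ltW.
Unshelve. all: by end_near. Qed.

Lemma diff_within_near x y (e : R) : Q x -> Q y -> 0 < e ->
  \forall t \near 0^'+, `|d (t *: y + (1 - t) *: x) - d x
    - t * 'd d (within Q (nbhs x)) (y - x)| <= t * e.
Proof.
move=> Qx Qy e0.
(* [differentiable] expands [d] around the [lim] of its filter, which has to be identified with [x];
   the filter is proper because [x] lies in the closure of [Q]. *)
have limQ : lim (within Q (nbhs x)) = x.
  apply: (@cvg_lim E (@norm_hausdorff R E) E (within Q (nbhs x)) _ idfun x).
    by apply: within_nbhs_proper; exact: subset_closure.
  exact: cvg_within.
have [[_]] := diffd Qx; rewrite limQ => /eqaddoP dE.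
(* The [+ 1] keeps the denominator positive when [y = x]. *)
have e'0 : 0 < e / (`|y - x| + 1) by rewrite divr_gt0// ltr_wpDl.
have {dE} : \forall t \near 0^'+, `|(d - (cst (d x) + 'd d (within Q (nbhs x)) \o
    center x)) (t *: y + (1 - t) *: x)| <=
    e / (`|y - x| + 1) * `|t *: y + (1 - t) *: x - x|.
  exact: (segment_cvg_within Qx Qy (dE _ e'0)).
apply: filter_app; near=> t.
have /andP[t0 t1] : 0 < t < 1 by near: t; exact: near_right0_01.
have zE : t *: y + (1 - t) *: x - x = t *: (y - x).
  by rewrite scalerBl scale1r scalerBr addrA addrAC addrK.
rewrite !fctE /= zE linearZ/= normrZ gtr0_norm// opprD addrA.
move=> /le_trans; apply.
rewrite mulrCA ler_pM2l// mulrAC ler_pdivrMr ?ltr_wpDl// ler_pM2l// lerDl.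
Unshelve. all: by end_near. Qed.

(** A bound on all difference quotients passes to the limit, up to an arbitrary [e]. Through this
    lemma and its mirror image below, convexity and minimality yield inequalities on the
    differential. *)
Lemma ge_diff_within x y a : Q x -> Q y ->
  (forall t, 0 < t < 1 -> t * a <= d (t *: y + (1 - t) *: x) - d x) ->
  a <= 'd d (within Q (nbhs x)) (y - x).
Proof.
move=> Qx Qy H; apply/ler_addgt0Pr => e e0.
set D : R := 'd d (within Q (nbhs x)) (y - x).
near (0 : R)^'+ => t.
have t01 : 0 < t < 1 by near: t; exact: near_right0_01.
have : `|d (t *: y + (1 - t) *: x) - d x - t * D| <= t * e.
  by near: t; exact: diff_within_near.
have /andP[t0 _] := t01.
rewrite ler_norml => /andP[_ Ht]; rewrite -(ler_pM2l t0) mulrDr.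
by move: Ht (H t t01); lra.
Unshelve. all: by end_near. Qed.

Lemma le_diff_within x y a : Q x -> Q y ->
  (forall t, 0 < t < 1 -> d (t *: y + (1 - t) *: x) - d x <= t * a) ->
  'd d (within Q (nbhs x)) (y - x) <= a.
Proof.
move=> Qx Qy H; apply/ler_addgt0Pr => e e0.
set D : R := 'd d (within Q (nbhs x)) (y - x).
near (0 : R)^'+ => t.
have t01 : 0 < t < 1 by near: t; exact: near_right0_01.
have : `|d (t *: y + (1 - t) *: x) - d x - t * D| <= t * e.
  by near: t; exact: diff_within_near.
have /andP[t0 _] := t01.
rewrite ler_norml => /andP[Ht _]; rewrite -(ler_pM2l t0) mulrDr.
by move: Ht (H t t01); lra.
Unshelve. all: by end_near. Qed.

Lemma bregman_ge0 x y : convex_function Q d -> Q x -> Q y ->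
  0 <= bregman Q d y x.
Proof.
move=> cvxd Qx Qy; rewrite /bregman subr_ge0.
apply: le_diff_within => // t /andP[t0 t1].
have t01 : 0 <= t <= 1 by rewrite !ltW.
by have := convex_function_segment cvxd Qx Qy t01; lra.
Qed.

(** At a minimizer the differential is nonnegative in every direction pointing into [Q]. *)
Lemma bregman_argmin_le x y : argmin Q d x -> Q y ->
  bregman Q d y x <= d y - d x.
Proof.
move=> [Qx xmin] Qy; rewrite gerBl; apply: ge_diff_within => // t /andP[t0 t1].
rewrite mulr0 subr_ge0; apply: xmin; apply: convex_set_segment => //.
by rewrite !ltW.
Qed.

(* The first-order optimality condition for the proximal problem at z, combined
   with the three-point identity
   V(y, x) - V(y, z) - V(z, x) = <d'(z) - d'(x), y - z>. *)
Lemma Mirr_three_point (h : R) (psi : E -> E -> R) x y z :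
  0 < h -> Q x -> Q y -> convex_function Q (psi^~ x) -> Mirr Q d h x psi z ->
  h * psi z x + bregman Q d z x + bregman Q d y z
    <= h * psi y x + bregman Q d y x.
Proof.
move=> h0 Qx Qy cvxpsi [Qz zmin].
have : h * (psi z x - psi y x) + 'd d (within Q (nbhs x)) (y - z)
    <= 'd d (within Q (nbhs z)) (y - z).
  (* Moving from [z] towards [y] changes the divergence from [x] by the increment of [d] minus a
     term linear in [t]. Minimality of [z] and convexity of [psi] thus bound that increment below by
     a multiple of [t]. *)
  apply: ge_diff_within => // t /andP[t0 t1].
  have t01 : 0 <= t <= 1 by rewrite !ltW.
  have := convex_function_segment cvxpsi Qz Qy t01.
  have := zmin _ (convex_set_segment cvxQ Qz Qy t01).
  have -> : bregman Q d (t *: y + (1 - t) *: z) x = bregman Q d z x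
      + (d (t *: y + (1 - t) *: z) - d z - t * 'd d (within Q (nbhs x)) (y - z)).
    rewrite /bregman; have -> : t *: y + (1 - t) *: z - x = t *: (y - z) + (z - x).
      by rewrite scalerBl scale1r scalerBr [z - t *: z]addrC !addrA.
    set D := 'd d (within Q (nbhs x)).
    have -> : D (t *: (y - z) + (z - x)) = t * D (y - z) + D (z - x).
      by rewrite linearD linearZ.
    ring.
  set w := t *: y + _; rewrite mulrDr -(ler_pM2l h0) !mulrDr !mulrA.
  by rewrite divff ?gt_eqF// !mul1r => H1; rewrite -(ler_pM2l h0); nra.
have -> : 'd d (within Q (nbhs x)) (y - z) =
    'd d (within Q (nbhs x)) (y - x) - 'd d (within Q (nbhs x)) (z - x).
  by rewrite -linearB opprB addrA subrK.
by rewrite /bregman; lra.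
Qed.

Lemma Mirr_descent (h delta Mf : R) (f : E -> R) (psi : E -> E -> R) x y z :
  0 < h -> 0 <= Mf -> convex_function Q d ->
  relative_model Q d delta Mf f psi ->
  Q x -> Q y -> Mirr Q d h x psi z ->
  h * (f x - f y) + bregman Q d y z
    <= bregman Q d y x + h ^+ 2 * Mf ^+ 2 / 2 + h * delta.
Proof.
move=> h0 Mf0 cvxd [fpsi psi_lb cvxpsi _] Qx Qy zM; have [Qz _] := zM.
have := Mirr_three_point h0 Qx Qy (cvxpsi x Qx) zM.
have := psi_lb _ _ Qx Qz; have := fpsi _ _ Qx Qy.
have V0 := bregman_ge0 cvxd Qx Qz.
set s := Num.sqrt _.
have s2 : s ^+ 2 = 2 * bregman Q d z x by rewrite sqr_sqrtr// mulr_ge0.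
move: s s2 => s s2 H1 H2 H3.
(* AM-GM: [2 h Mf s <= (h Mf) ^ 2 + s ^ 2] *)
have amgm : 0 <= (h * Mf - s) ^+ 2 by exact: sqr_ge0.
have {}H1 : h * (f x + psi y x) <= h * f y by rewrite ler_pM2l.
have {}H2 : h * - psi z x <= h * (Mf * s + delta) by rewrite ler_pM2l.
by nra.
Qed.

End directional_derivative.

(** * Runs of Algorithm E *)

Section algorithmE.
Context (R : realType) (E : normedModType R) (Q : set E) (d : E -> R).
Context (eps delta M : R) (N : nat) (f : 'I_N -> E -> R) (g : E -> R).
Context (psif : 'I_N -> E -> E -> R) (psig : E -> E -> R).
Context (Mf : 'I_N -> R) (Mg : R).
Context (K : nat) (ctr : nat -> nat) (x : nat -> E) (k : 'I_N -> nat).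
Hypotheses (eps_gt0 : 0 < eps) (M_gt0 : 0 < M).
Hypotheses (Mf_ge0 : forall i, 0 <= Mf i) (Mf_le : forall i, Mf i <= M).
Hypotheses (Mg_ge0 : 0 <= Mg) (Mg_le : Mg <= M).
Hypotheses (cvxQ : convex_set Q) (diffd : differentiable_on Q d).
Hypothesis cvxd : convex_function Q d.
Hypothesis modelf :
  forall i, relative_model Q d delta (Mf i) (f i) (psif i).
Hypothesis modelg : relative_model Q d delta Mg g psig.
Hypothesis runE : algorithmE_run Q d eps delta M g psif psig K ctr x.
Hypothesis kP : forall i : 'I_N,
  [/\ (k i < K)%N, productive eps delta g (x (k i)) & ctr (k i) = i].

Lemma run_mem n : (n <= K)%N -> Q (x n).
Proof.
case: n => [_|n ltnK]; first by have [[[]]] := runE.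
have [prod|nprod] := boolP (productive eps delta g (x n)).
  by have [_ [j [_ []]]] := run_productive runE ltnK prod.
by have [_ []] := run_nonproductive runE ltnK nprod.
Qed.

Lemma run_ctrS n : (n < K)%N ->
  ctr n.+1 = (ctr n + productive eps delta g (x n))%N.
Proof.
move=> ltnK; have [prod|nprod] := boolP (productive eps delta g (x n)).
  by rewrite addn1; have [] := run_productive runE ltnK prod.
by rewrite addn0; have [] := run_nonproductive runE ltnK nprod.
Qed.

Lemma run_ctr_le m n : (m <= n)%N -> (n <= K)%N -> (ctr m <= ctr n)%N.
Proof.
move=> /subnK <-; elim: (n - m)%N => [//|p IH] ltK.
by rewrite run_ctrS// (leq_trans (IH (ltnW ltK)))// leq_addr.
Qed.

(** A productive step strictly increases the counter, which never decreases. This identifies the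
    given [k j] with the step at which the run uses the model of [f j]. *)
Lemma run_productive_inj m n : (m < K)%N -> (n < K)%N ->
  productive eps delta g (x m) -> productive eps delta g (x n) ->
  ctr m = ctr n -> m = n.
Proof.
have lt_ctr p q : (q < K)%N -> (p < q)%N -> productive eps delta g (x p) ->
    (ctr p < ctr q)%N.
  move=> qK pq prod; apply: leq_trans (run_ctr_le pq (ltnW qK)).
  by rewrite run_ctrS ?(ltn_trans pq)// prod addn1.
move=> mK nK pm pn eq_ctr; case: (ltngtP m n) => // mn.
  by have := lt_ctr _ _ nK mn pm; rewrite eq_ctr ltnn.
by have := lt_ctr _ _ mK mn pn; rewrite eq_ctr ltnn.
Qed.

Let h := eps / M ^+ 2.

Let h_gt0 : 0 < h. Proof. by rewrite divr_gt0 ?exprn_gt0. Qed.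

(* The step size is chosen so that h ^ 2 M ^ 2 = h eps. *)
Lemma Mirr_step (C : R) (F : E -> R) (psi : E -> E -> R) u y z :
  0 <= C -> C <= M -> relative_model Q d delta C F psi ->
  Q u -> Q y -> Mirr Q d h u psi z ->
  h * (F u - F y) + bregman Q d y z
    <= bregman Q d y u + h * (eps / 2 + delta).
Proof.
move=> C0 CM model Qu Qy zM.
apply: le_trans (Mirr_descent cvxQ diffd h_gt0 C0 cvxd model Qu Qy zM) _.
rewrite -addrA lerD2l mulrDr lerD2r [leRHS]mulrA ler_pM2r ?invr_gt0//.
have -> : h * eps = h ^+ 2 * M ^+ 2.
  by rewrite expr2 -mulrA; congr (_ * _); rewrite /h divfK// expf_neq0// gt_eqF.
by rewrite ler_pM2l ?exprn_gt0// lerXn2r// ?nnegrE// ltW.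
Qed.

(** Loop invariant, by induction on the number of steps: the indices below [ctr n] are those of the
    productive steps already made, and only these are charged [h * (eps / 2 + delta)]. *)
Lemma run_telescope (y : E) n : Q y -> g y <= 0 -> (n <= K)%N ->
  h * (\sum_(i < N | (i < ctr n)%N) (f i (x (k i)) - f i y))
    + h * (\sum_(m < n) ~~ productive eps delta g (x m))%:R * (eps / 2)
    + bregman Q d y (x n)
  <= (ctr n)%:R * (h * (eps / 2 + delta)) + bregman Q d y (x 0%N).
Proof.
move=> Qy gy; elim: n => [_|n IH ltnK].
  have [[_ ->] _ _ _ _] := runE.
  by rewrite big_pred0// big_ord0 !(mulr0, mul0r) !add0r.
have {}IH := IH (ltnW ltnK); have Qxn := run_mem (ltnW ltnK).
rewrite big_ord_recr/= run_ctrS//.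
have [prod|nprod] := boolP (productive eps delta g (x n)).
  have [_ [j [ctrn xSn]]] := run_productive runE ltnK prod.
  have kj : k j = n.
    by have [kK kprod kctr] := kP j; apply: run_productive_inj => //; rewrite ctrn.
  (* Incrementing the counter from [j] adds exactly the index [j] to the sum. *)
  have -> : \sum_(i < N | (i < ctr n + 1)%N) (f i (x (k i)) - f i y) =
      f j (x n) - f j y + \sum_(i < N | (i < ctr n)%N) (f i (x (k i)) - f i y).
    rewrite (bigD1 j)/=; last by rewrite ctrn addn1.
    rewrite kj; congr (_ + _); apply: eq_bigl => i.
    by rewrite addn1 ltnS ctrn ltn_neqAle andbC.
  have := Mirr_step (Mf_ge0 j) (Mf_le j) (modelf j) Qxn Qy xSn.
  by rewrite /= addn0 natrD; lra.
have [_ xSn] := run_nonproductive runE ltnK nprod.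
have := Mirr_step Mg_ge0 Mg_le modelg Qxn Qy xSn.
(* The excess over the error [h * (eps / 2 + delta)] of the step is [h * (eps / 2)], the credit of a
   non-productive step. *)
have : h * (eps + delta) <= h * (g (x n) - g y).
  by rewrite ler_pM2l//; move: nprod; rewrite -ltNge => /ltW; lra.
by rewrite /= addn0 natrD; lra.
Qed.

End algorithmE.

(** * Regret bound and count of non-productive steps *)

Lemma regret_argmin (R : realType) (T : Type) (Q : set T) (g : T -> R)
    (N : nat) (f : 'I_N -> T -> R) (z : 'I_N -> T) (y : T) :
  argmin (Q `&` [set y | g y <= 0]) (average f) y ->
  regret Q g f z = N%:R^-1 * \sum_(i < N) (f i (z i) - f i y).
Proof.
move=> [Ay ymin]; rewrite /regret sumrB mulrBr; congr (_ - _).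
rewrite -/(average f y); apply/eqP; rewrite eq_le; apply/andP; split.
  apply: ge_inf; last by exists y.
  by exists (average f y) => _ [z' /ymin Az' <-].
apply: lb_le_inf; first by exists (average f y), y.
by move=> _ [z' /ymin Az' <-].
Qed.

Lemma card_nonproductive_steps (R : realType) (T : Type) (eps delta : R)
    (g : T -> R) (K : nat) (x : nat -> T) :
  #|nonproductive_steps eps delta g K x|
    = (\sum_(m < K) ~~ productive eps delta g (x m))%N.
Proof.
rewrite -sum1_card big_mkcond/=; apply: eq_bigr => m _.
by rewrite inE; case: (~~ _).
Qed.

Theorem theorem4p1 (R : realType) (eps delta Theta0 Mbar : R)
    (eps_gt0 : 0 < eps) (delta_gt0 : 0 < delta) (Theta0_gt0 : 0 < Theta0)
    (Mbar_gt0 : 0 < Mbar) :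
  exists C : R,
  forall (E : normedVectType R) (Q : set E) (d : E -> R)
    (N : nat) (f : 'I_N -> E -> R) (g : E -> R)
    (psif : 'I_N -> E -> E -> R) (psig : E -> E -> R)
    (Mf : 'I_N -> R) (Mg : R)
    (xstar : E) (K : nat) (ctr : nat -> nat) (x : nat -> E) (k : 'I_N -> nat),
  let M := \big[Num.max/Mg]_(i < N) Mf i in
  closed Q -> convex_set Q ->
  convex_function Q d -> differentiable_on Q d ->
  (0 < N)%N ->
  (forall i, 0 < Mf i) -> 0 < Mg -> M <= Mbar ->
  (forall i, relative_model Q d delta (Mf i) (f i) (psif i)) ->
  relative_model Q d delta Mg g psig ->
  argmin (Q `&` [set y | g y <= 0]) (average f) xstar ->
  d xstar <= Theta0 ^+ 2 ->
  algorithmE_run Q d eps delta M g psif psig K ctr x ->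
  0 <= d (x 0%N) ->
  (forall i : 'I_N,
     [/\ (k i < K)%N, productive eps delta g (x (k i)) & ctr (k i) = i]) ->
  let nJ := #|nonproductive_steps eps delta g K x| in
  let Reg := regret Q g f (fun i => x (k i)) in
  Reg <= kappa eps delta M Theta0 N nJ /\
  (0 <= Reg -> nJ%:R <= C * N%:R).
Proof.
(* For nonnegative regret the final estimate gives [nJ * (eps / 2) <= N * (eps / 2 + delta) + M ^+ 2
   * Theta0 ^+ 2 / eps]; divide by [eps / 2], using [M <= Mbar] and [1 <= N]. *)
exists (1 + 2 * delta / eps + 2 * Mbar ^+ 2 * Theta0 ^+ 2 / eps ^+ 2).
move=> E Q d N f g psif psig Mf Mg xs K ctr x k M _ cvxQ cvxd diffd N_gt0.
move=> Mf_gt0 Mg_gt0 M_le modelf modelg xs_min dxs runE dx0 kP nJ Reg.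
have Mg_le : Mg <= M by exact: bigmax_ge_id.
have Mf_le i : Mf i <= M by exact: le_bigmax_cond.
have M_gt0 : 0 < M by exact: lt_le_trans Mg_le.
have [[Qxs gxs] _] := xs_min.
have [[x0_min _] _ _ _ ctrK] := runE.
have Vx0 : bregman Q d xs (x 0%N) <= Theta0 ^+ 2.
  apply: le_trans (bregman_argmin_le cvxQ diffd x0_min Qxs) _.
  by rewrite lerBlDr (le_trans dxs)// lerDl.
have VxK : 0 <= bregman Q d xs (x K).
  by apply: bregman_ge0 => //; exact: run_mem runE _ (leqnn K).
have := run_telescope eps_gt0 M_gt0 (fun i => ltW (Mf_gt0 i)) Mf_le
  (ltW Mg_gt0) Mg_le cvxQ diffd cvxd modelf modelg runE kP Qxs gxs (leqnn K).
rewrite ctrK -card_nonproductive_steps -/nJ.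
under eq_bigl => i do rewrite ltn_ord.
have -> : \sum_(i < N) (f i (x (k i)) - f i xs) = N%:R * Reg.
  by rewrite /Reg (regret_argmin _ xs_min) mulVKf// pnatr_eq0 -lt0n.
have N0 : 0 < N%:R :> R by rewrite ltr0n.
move=> H.
have {}H : N%:R * Reg + nJ%:R * (eps / 2)
    <= N%:R * (eps / 2 + delta) + M ^+ 2 * Theta0 ^+ 2 / eps.
  have h_gt0 : 0 < eps / M ^+ 2 by rewrite divr_gt0 ?exprn_gt0.
  (* Dividing the telescoped inequality by [h = eps / M ^+ 2] turns [Theta0 ^+ 2] into
     [M ^+ 2 * Theta0 ^+ 2 / eps]. *)
  rewrite -(ler_pM2l h_gt0).
  have -> : eps / M ^+ 2 * (N%:R * (eps / 2 + delta) + M ^+ 2 * Theta0 ^+ 2 / eps)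
      = N%:R * (eps / M ^+ 2 * (eps / 2 + delta)) + Theta0 ^+ 2.
    by field; rewrite !gt_eqF.
  by move: H; lra.
have Reg_le : Reg <= kappa eps delta M Theta0 N nJ.
  rewrite -(ler_pM2l N0) /kappa.
  have -> : N%:R * (nJ%:R / N%:R * - (eps / 2) + (eps / 2 + delta)
      + M ^+ 2 * Theta0 ^+ 2 / (N%:R * eps))
    = - nJ%:R * (eps / 2) + N%:R * (eps / 2 + delta) + M ^+ 2 * Theta0 ^+ 2 / eps.
    by field; rewrite !gt_eqF.
  by move: H; lra.
split=> // Reg_ge0.
have N_ge1 : 1 <= N%:R :> R by rewrite ler1n.
(* The term independent of [N] is absorbed into a multiple of [N], since [1 <= N]. *)
have MT : M ^+ 2 * Theta0 ^+ 2 / eps <= N%:R * (Mbar ^+ 2 * Theta0 ^+ 2 / eps).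
  have MT' : M ^+ 2 * Theta0 ^+ 2 / eps <= Mbar ^+ 2 * Theta0 ^+ 2 / eps.
    rewrite ler_pM2r ?invr_gt0// ler_pM2r ?exprn_gt0//.
    by rewrite lerXn2r// ?nnegrE ltW.
  apply: (le_trans MT'); rewrite ler_peMl//.
  by rewrite divr_ge0 ?mulr_ge0 ?sqr_ge0 ?ltW.
have NReg : 0 <= N%:R * Reg by rewrite mulr_ge0.
have e2 : 0 < eps / 2 by rewrite divr_gt0.
rewrite -(ler_pM2r e2).
have -> : (1 + 2 * delta / eps + 2 * Mbar ^+ 2 * Theta0 ^+ 2 / eps ^+ 2) * N%:R
    * (eps / 2) = N%:R * (eps / 2 + delta) + N%:R * (Mbar ^+ 2 * Theta0 ^+ 2 / eps).
  by field; rewrite gt_eqF.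
by lra.
Qed.
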